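(* Let $a<b$ be real numbers, let $D>0$ and $\alpha\ge 0$ be constants, let $f\in L^2(a,b)$ satisfy $f\ge 0$ almost everywhere, and let $c_a,c_b\ge 0$. Divide $[a,b]$ into $N\ge 2$ elements of equal size $h=(b-a)/N$, with nodes $x_i=a+ih$, $i=0,\dots,N$. Let $c^h$ be the solution of the classical Galerkin formulation with two-node linear finite elements on this mesh for the problem $$\alpha\, c(x)-D\,c''(x)=f(x)\ \text{ in }(a,b),\qquad c(a)=c_a,\quad c(b)=c_b .$$ If $$h\le\sqrt{\frac{6D}{\alpha}}$$ (a condition regarded as always satisfied when $\alpha=0$), then the nodal concentrations are non-negative: $c^h(x_i)\ge 0$ for all $i=0,\dots,N$.
   Context: Let $V^h$ be the space of continuous functions on $[a,b]$ whose restriction to each element $[x_{i-1},x_i]$, $i=1,\dots,N$, is a polynomial of degree at most one. The classical (single-field) Galerkin formulation with two-node linear finite elements is: find $c^h\in V^h$ with $c^h(a)=c_a$ and $c^h(b)=c_b$ such that $$\int_a^b D\,(w^h)'(x)\,(c^h)'(x)\,dx+\int_a^b \alpha\, w^h(x)\,c^h(x)\,dx=\int_a^b w^h(x)\,f(x)\,dx$$ for all $w^h\in V^h$ with $w^h(a)=w^h(b)=0$. All integrals are evaluated exactly. This problem has a unique solution $c^h$. The nodal concentrations are the values $c^h(x_i)$. Under the stated sign conditions on $f$, $c_a$, $c_b$, the maximum principle for the continuous problem gives $c\ge 0$, and satisfaction of the maximum principle by the discrete solution is understood as non-negativity of the nodal concentrations. *)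

(* Defs.v *)
From HB Require Import structures.
From mathcomp Require Import all_boot all_order all_algebra.
From mathcomp Require Import all_classical all_reals all_analysis.
Import Order.TTheory GRing.Theory Num.Theory.
Import numFieldNormedType.Exports.

Set Implicit Arguments.
Unset Strict Implicit.
Unset Printing Implicit Defensive.

Local Open Scope classical_set_scope.
Local Open Scope ring_scope.

Definition mesh_size (R : realType) (a b : R) (N : nat) : R := (b - a) / N%:R.

Definition node (R : realType) (a b : R) (N i : nat) : R :=
  a + i%:R * mesh_size a b N.

(* L^2(a, b): the extension of f by zero outside ]a, b[ is measurable and
   square integrable on the line. *)
Definition L2_on (R : realType) (a b : R) (f : R -> R) : Prop :=
  patch (fun=> 0) `]a, b[ f \in Lfun (@lebesgue_measure R) 2%:E.

(* Functions on [a, b] are represented by functions on R whose values outside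
   [a, b] are irrelevant. *)
Definition P1_space (R : realType) (a b : R) (N : nat) : set (R -> R) :=
  [set v | {within `[a, b], continuous v} /\
           forall i : nat, (i < N)%N ->
             exists2 p : {poly R}, (size p <= 2)%N &
               {in `[node a b N i, node a b N i.+1], forall x, v x = p.[x]}].

(* The derivatives derive1 v are classical ones; for v in P1_space they exist except
   possibly at the finitely many nodes, where the arbitrary value given by the
   total operator derive1 does not affect the integrals. *)
Definition galerkin_solution (R : realType) (a b D alpha : R) (f : R -> R)
    (ca cb : R) (N : nat) (c : R -> R) : Prop :=
  [/\ P1_space a b N c, c a = ca, c b = cb &
    forall w : R -> R, P1_space a b N w -> w a = 0 -> w b = 0 ->
      \int[@lebesgue_measure R]_(x in `[a, b]) (D * derive1 w x * derive1 c x)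
      + \int[@lebesgue_measure R]_(x in `[a, b]) (alpha * w x * c x)
      = \int[@lebesgue_measure R]_(x in `[a, b]) (w x * f x)].

(* Main.v *)
Require Import Defs.
From HB Require Import structures.
From mathcomp Require Import all_boot all_order all_algebra.
From mathcomp Require Import all_classical all_reals all_analysis.
From mathcomp Require Import measurable_realfun pi_irrational ring lra.
Import Order.TTheory GRing.Theory Num.Theory.
Import numFieldNormedType.Exports.

Set Implicit Arguments.
Unset Strict Implicit.

Local Open Scope classical_set_scope.
Local Open Scope ring_scope.

(** The hat function of an interior node is an admissible test function, and it
is supported on two elements only. With the nodal values c_i and mesh size h the
Galerkin identity for it reads
[[
  D/h (2 c_i - c_(i-1) - c_(i+1)) + alpha h/6 (c_(i-1) + 4 c_i + c_(i+1)) = F_i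
]]
where F_i is the integral of f against the hat function
([galerkin_nodal_equation]). As f is non-negative almost everywhere and the hat
function is non-negative, F_i is non-negative ([load_ge0]). Put
k = D/h - alpha h/6 and e = alpha h; the left-hand side is then
(2 k + e) c_i - k (c_(i-1) + c_(i+1)). The bound on the mesh size says exactly
that k >= 0, that is, that the off-diagonal entries of the system matrix are
non-positive. Each interior value is then bounded below by a combination of its
neighbours with non-negative weights of total mass at most 1, so a negative
minimum cannot occur away from the boundary ([discrete_maximum_principle]).

Both integrands on the left are polynomials of degree at most two on each
element, apart from the nodes where derivatives carry arbitrary values; Simpson's
rule integrates such functions exactly ([integral_simpson]), which gives the
element contributions [stiffness_hat] and [mass_hat]. *)

(** * The discrete maximum principle *)

(** At the first index where the minimum is attained, the left neighbour is
strictly larger and the right one is no smaller. If the minimum were negative,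
the inequality at that index would force both k and e to vanish. *)
Lemma discrete_maximum_principle (R : realFieldType) (k e : R) (N : nat)
    (c : nat -> R) :
  0 <= k -> 0 <= e -> 0 < k + e -> 0 <= c 0%N -> 0 <= c N ->
  (forall i, (0 < i < N)%N ->
    k * (c i.-1 + c i.+1) <= (2 * k + e) * c i) ->
  forall i, (i <= N)%N -> 0 <= c i.
Proof.
move=> k0 e0 ke0 c0 cN cc i iN; rewrite leNgt; apply/negP => ci.
pose j0 := [arg min_(j < (inord i : 'I_N.+1)) c j]%O.
have min_j0 j : (j <= N)%N -> c j0 <= c j.
  rewrite /j0; case: arg_minP => //= n _ nmin jN.
  by have := nmin (inord j) isT; rewrite inordK.
have ex : exists j, (j <= N)%N && (c j == c j0).
  by exists j0; rewrite eqxx -ltnS ltn_ord.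
case: (ex_minnP ex) => j /andP[jN /eqP cj] jmin.
have cj0 : c j < 0 by rewrite cj (le_lt_trans (min_j0 _ iN)).
have j_gt0 : (0 < j)%N by case: (j) cj0 => //; rewrite ltNge c0.
have j_ltN : (j < N)%N.
  by rewrite ltn_neqAle jN andbT; apply/eqP => jE; move: cj0; rewrite jE ltNge cN.
have cjp : c j < c j.-1.
  rewrite cj lt_neqAle min_j0 ?andbT ?(leq_trans (leq_pred j))//.
  apply/eqP => cE; have := jmin j.-1.
  rewrite -cE eqxx (leq_trans (leq_pred j) jN) => /(_ isT).
  by rewrite leqNgt prednK// leqnn.
have cjs : c j <= c j.+1 by rewrite cj min_j0.
have := cc j; rewrite j_gt0 j_ltN => /(_ isT).
move: k0 e0 ke0 cj0 cjp cjs; move: (c j) (c j.-1) (c j.+1) => x y z.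
move=> k0 e0 ke0 x0 xy xz H.
have kx : k * (z - x) >= 0 by rewrite mulr_ge0// subr_ge0.
have ex0 : e * - x >= 0 by rewrite mulr_ge0// oppr_ge0 ltW.
have [k_gt0|] := ltP 0 k.
  have : k * (y - x) > 0 by rewrite mulr_gt0// subr_gt0.
  by lra.
move=> kle0; have e_gt0 : 0 < e by lra.
have : e * - x > 0 by rewrite mulr_gt0// oppr_gt0.
have : k * (y - x) >= 0 by rewrite mulr_ge0// subr_ge0 ltW.
by lra.
Qed.

(** * Polynomials of degree at most one *)

Lemma horner_size2 (R : nzRingType) (p : {poly R}) (x : R) :
  (size p <= 2)%N -> p.[x] = p`_0 + p`_1 * x.
Proof.
move=> sp; rewrite (horner_coef_wide _ sp) 2!big_ord_recl big_ord0 /=.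
by rewrite expr0 mulr1 expr1 addr0.
Qed.

Lemma horner_deriv_size2 (R : nzRingType) (p : {poly R}) (x : R) :
  (size p <= 2)%N -> p^`().[x] = p`_1.
Proof.
move=> sp; rewrite horner_size2; last first.
  by rewrite (leq_trans (size_poly _ _))// (leq_trans (leq_pred _)).
by rewrite !coef_deriv mulr1n [p`_2]nth_default// mul0rn mul0r addr0.
Qed.

Lemma size_affine_le2 (R : nzRingType) (c d : R) :
  (size (c%:P + d *: 'X)%R <= 2)%N.
Proof.
rewrite (leq_trans (size_polyD _ _))// geq_max (leq_trans (size_polyC_leq1 _))//.
by rewrite (leq_trans (size_scale_leq _ _))// size_polyX.
Qed.

(** * Integrals of piecewise quadratic functions *)

Section quadrature.
Context {R : realType}.
Notation mu := (@lebesgue_measure R).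
Implicit Types (p q : {poly R}) (s t m : R) (g v : R -> R).

Lemma derive1_poly_itv v p s t :
  {in `]s, t[, v =1 horner p} -> {in `]s, t[, derive1 v =1 horner p^`()}.
Proof.
move=> vp x xst; rewrite derivE !derive1E; apply: near_eq_derive.
by near=> y; apply: vp; near: y; exact: near_in_itvoo.
Unshelve. all: by end_near. Qed.

Definition simpson p s t : R :=
  (t - s) / 6 * (p.[s] + 4 * p.[(s + t) / 2] + p.[t]).

Lemma measurable_poly_itv g p s t (b0 b1 : bool) : {in `]s, t[, g =1 horner p} ->
  measurable_fun [set` Interval (BSide b0 s) (BSide b1 t)] g.
Proof.
move=> gp; have mg : measurable_fun `]s, t[ g.
  apply: (@eq_measurable_fun _ _ _ _ _ (horner p)) => [x|].
    by rewrite inE /= => /gp.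
  exact: measurable_poly.
move: b0 b1 => [|] [|] //.
- exact/measurable_fun_itv_obnd_cbndP.
- exact/measurable_fun_itv_bndo_bndcP/measurable_fun_itv_obnd_cbndP.
- exact/measurable_fun_itv_bndo_bndcP.
Qed.

(** The equality with a polynomial is required on the open interval only, since
the integrands built from derivatives are arbitrary at the nodes. Exactness
comes from the explicit antiderivative of a quadratic polynomial. *)
Lemma integral_simpson g p s t (b0 b1 : bool) : s < t -> (size p <= 3)%N ->
  {in `]s, t[, g =1 horner p} ->
  (\int[mu]_(x in [set` Interval (BSide b0 s) (BSide b1 t)]) (g x)%:E
   = (simpson p s t)%:E)%E.
Proof.
move=> st sp gp; rewrite integral_itv_bndoo; last first.
  by apply/measurable_EFinP; exact: (@measurable_poly_itv _ _ _ _ false true gp).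
(* The fundamental theorem of calculus is stated on the closed interval, so the
   endpoints come back once g is replaced by p. *)
transitivity (\int[mu]_(x in `]s, t[) p.[x]%:E)%E.
  by apply: eq_integral => x; rewrite inE /= => /gp ->.
rewrite -(@integral_itv_bndoo _ _ _ _ true false); last first.
  by apply/measurable_EFinP; exact: (@measurable_poly_itv (horner p) p).
pose P := p`_0 *: 'X + (p`_1 / 2) *: 'X^2 + (p`_2 / 3) *: 'X^3.
have pE x : p.[x] = p`_0 + p`_1 * x + p`_2 * x ^+ 2.
  rewrite (horner_coef_wide _ sp) !big_ord_recl big_ord0 /=.
  by rewrite expr0 mulr1 expr1 addr0 addrA.
rewrite (@continuous_FTC2 _ _ (horner P)) //.
- rewrite -EFinB /simpson !pE /P !hornerE /=; congr EFin; by field.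
- by apply: continuous_subspaceT; exact: continuous_horner.
- split.
  + by move=> x _; exact: derivable_horner.
  + by apply: cvg_at_right_filter; exact: continuous_horner.
  + by apply: cvg_at_left_filter; exact: continuous_horner.
- move=> x _; rewrite -derivE pE /P !(derivD, derivZ, derivX, derivXn) !hornerE /=.
  by field.
Qed.

Lemma Rintegral_simpson2 g p q s m t : s < m -> m < t ->
  (size p <= 3)%N -> (size q <= 3)%N ->
  {in `]s, m[, g =1 horner p} -> {in `]m, t[, g =1 horner q} ->
  \int[mu]_(x in `[s, t]) g x = simpson p s m + simpson q m t.
Proof.
move=> sm mt sp sq gp gq; rewrite /Rintegral.
rewrite (@itv_bndbnd_setU _ _ _ (BRight m)) ?bnd_simp ?ltW//.
rewrite integral_setU//=.
- by rewrite (@integral_simpson g p s m)// (@integral_simpson g q m t).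
- apply/measurable_EFinP/measurable_funU => //; split.
  + exact: measurable_poly_itv gp.
  + exact: measurable_poly_itv gq.
- apply/disj_setPRL => x /=; rewrite !in_itv/= => /andP[mx _].
  by apply/negP; rewrite negb_and -!ltNge mx orbT.
Qed.

Lemma Rintegral_restrict g (A B : set R) : B `<=` A ->
  (forall x, A x -> ~ B x -> g x = 0) ->
  \int[mu]_(x in A) g x = \int[mu]_(x in B) g x.
Proof.
move=> BA g0; rewrite -[B in RHS](setIidr BA) Rintegral_mkcondr.
apply: eq_Rintegral => x; rewrite inE => Ax; rewrite patchE.
by case: ifPn => //; rewrite notin_setE => /g0 ->.
Qed.

(** An integrand that is non-negative almost everywhere has the same integral as
its absolute value. *)
Lemma Rintegral_ge0_ae (g : R -> R) (D : set R) :
  measurable D -> measurable_fun D g ->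
  {ae mu, forall x, D x -> 0 <= g x} -> 0 <= \int[mu]_(x in D) g x.
Proof.
move=> mD mg g0; rewrite /Rintegral fine_ge0//.
rewrite (@ae_eq_integral _ _ _ mu D (fun x => `|g x|%:E))//.
- by apply: integral_ge0 => x _; rewrite lee_fin.
- exact/measurable_EFinP.
- by apply/measurable_EFinP; exact: measurableT_comp.
- case: g0 => A [mA A0 subA]; exists A; split=> //.
  apply: subset_trans subA; apply: subsetC => x gx Dx.
  by rewrite ger0_norm// gx.
Qed.

End quadrature.

(** * Hat functions and their element integrals *)

Section hat.
Context {R : realType}.
Implicit Types (m h x : R).

Definition hat m h x : R := Num.max 0 (1 - `|x - m| / h).

Lemma hat_ge0 m h x : 0 <= hat m h x.
Proof. by rewrite /hat le_max lexx. Qed.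

Lemma continuous_hat m h : continuous (hat m h).
Proof.
move=> x; apply: (@continuous_max R R (fun=> 0) (fun x => 1 - `|x - m| / h)).
  exact: cvg_cst.
apply: cvgB; first exact: cvg_cst.
apply: cvgM; last exact: cvg_cst.
apply: cvg_norm; apply: cvgB; [exact: cvg_id|exact: cvg_cst].
Qed.

Lemma hat_left m h x : 0 < h -> m - h <= x <= m ->
  hat m h x = ((1 - m / h)%:P + h^-1 *: 'X).[x].
Proof.
move=> h0 /andP[mx xm]; rewrite /hat ler0_norm ?subr_le0// !hornerE max_r.
  by field; rewrite gt_eqF.
by rewrite subr_ge0 ler_pdivrMr// mul1r; lra.
Qed.

Lemma hat_right m h x : 0 < h -> m <= x <= m + h ->
  hat m h x = ((1 + m / h)%:P - h^-1 *: 'X).[x].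
Proof.
move=> h0 /andP[mx xm]; rewrite /hat ger0_norm ?subr_ge0// !hornerE max_r.
  by field; rewrite gt_eqF.
by rewrite subr_ge0 ler_pdivrMr// mul1r; lra.
Qed.

Lemma hat_out m h x : 0 < h -> (x <= m - h) || (m + h <= x) -> hat m h x = 0.
Proof.
move=> h0 xmh; rewrite /hat max_l// subr_le0 ler_pdivlMr// mul1r.
by case/orP: xmh => ?; [rewrite ler0_norm|rewrite ger0_norm]; lra.
Qed.

Lemma derive1_hat_out m h x : 0 < h -> (x < m - h) || (m + h < x) ->
  derive1 (hat m h) x = 0.
Proof.
move=> h0 /orP[xmh|xmh].
- rewrite (@derive1_poly_itv _ _ 0 (x - 1) (m - h)) ?deriv0 ?horner0//.
    move=> y; rewrite in_itv/= horner0 => /andP[_ /ltW ymh].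
    by rewrite hat_out// ymh.
  by rewrite in_itv/= xmh andbT; lra.
- rewrite (@derive1_poly_itv _ _ 0 (m + h) (x + 1)) ?deriv0 ?horner0//.
    move=> y; rewrite in_itv/= horner0 => /andP[/ltW ymh _].
    by rewrite hat_out// ymh orbT.
  by rewrite in_itv/= xmh /=; lra.
Qed.

(** Here p and q are the affine pieces of c on the two elements that meet at m,
and l and r those of the hat function centred at m. *)
Section element_integrals.
Variables (m h : R) (c : R -> R) (p q : {poly R}).
Hypotheses (h0 : 0 < h) (sp : (size p <= 2)%N) (sq : (size q <= 2)%N).
Hypotheses (cp : {in `[m - h, m], c =1 horner p})
  (cq : {in `[m, m + h], c =1 horner q}).
Notation mu := (@lebesgue_measure R).
Notation l := ((1 - m / h)%:P + h^-1 *: 'X).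
Notation r := ((1 + m / h)%:P - h^-1 *: 'X).

Let sm : m - h < m. Proof. by rewrite ltrBlDr ltrDl. Qed.
Let mt : m < m + h. Proof. by rewrite ltrDl. Qed.

Let hatl : {in `]m - h, m[, hat m h =1 horner l}.
Proof.
by move=> x /subset_itv_oo_cc; rewrite in_itv/= => ?; exact: hat_left.
Qed.

Let hatr : {in `]m, m + h[, hat m h =1 horner r}.
Proof.
by move=> x /subset_itv_oo_cc; rewrite in_itv/= => ?; exact: hat_right.
Qed.

Let cl : {in `]m - h, m[, c =1 horner p}.
Proof. by move=> x /subset_itv_oo_cc; exact: cp. Qed.

Let cr : {in `]m, m + h[, c =1 horner q}.
Proof. by move=> x /subset_itv_oo_cc; exact: cq. Qed.

Let sl : (size l <= 2)%N. Proof. exact: size_affine_le2. Qed.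
Let sr : (size r <= 2)%N.
Proof. by rewrite -scaleNr; exact: size_affine_le2. Qed.

Let ends : [/\ c (m - h) = p.[m - h], c m = p.[m], p.[m] = q.[m] &
  c (m + h) = q.[m + h]].
Proof.
by rewrite -!cp ?in_itv/= -?cq ?in_itv/= ?lexx ?(ltW sm) ?(ltW mt).
Qed.

Lemma stiffness_hat (D : R) :
  \int[mu]_(x in `[m - h, m + h]) (D * derive1 (hat m h) x * derive1 c x) =
  D / h * (2 * c m - c (m - h) - c (m + h)).
Proof.
rewrite (@Rintegral_simpson2 _ _ (D * h^-1 * p`_1)%:P (- (D * h^-1 * q`_1))%:P _ m)//.
(* Continuity of c at m eliminates the constant coefficient of q; what remains
   is a rational identity. *)
- have [-> -> pq ->] := ends; move: pq; rewrite /simpson !hornerC !horner_size2//.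
  move=> pq; have -> : q`_0 = p`_0 + p`_1 * m - q`_1 * m by rewrite pq addrK.
  by field; rewrite gt_eqF.
- by rewrite (leq_trans (size_polyC_leq1 _)).
- by rewrite (leq_trans (size_polyC_leq1 _)).
- move=> x xi; rewrite (derive1_poly_itv hatl xi) (derive1_poly_itv cl xi).
  by rewrite !horner_deriv_size2// !hornerE coefD coefC coefZ coefX /= add0r mulr1.
- move=> x xi; rewrite (derive1_poly_itv hatr xi) (derive1_poly_itv cr xi).
  rewrite !horner_deriv_size2// !hornerE coefB coefC coefZ coefX /= sub0r mulr1.
  by rewrite mulrN mulNr.
Qed.

(** The weights 1, 4, 1 are the row of the consistent mass matrix; the resulting
coupling alpha h/6 to the neighbours is what competes with the diffusive
coupling D/h. *)
Lemma mass_hat (alpha : R) :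
  \int[mu]_(x in `[m - h, m + h]) (alpha * hat m h x * c x) =
  alpha * h / 6 * (c (m - h) + 4 * c m + c (m + h)).
Proof.
have sz2 (u v : {poly R}) : (size u <= 2)%N -> (size v <= 2)%N ->
    (size (alpha *: (u * v))%R <= 3)%N.
  move=> su sv; rewrite (leq_trans (size_scale_leq _ _))//.
  rewrite (leq_trans (size_polyMleq _ _))//.
  by rewrite -subn1 leq_subLR (leq_trans (leq_add su sv)).
rewrite (@Rintegral_simpson2 _ _ (alpha *: (l * p)) (alpha *: (r * q)) _ m)//.
- have [-> -> pq ->] := ends; move: pq.
  rewrite /simpson !hornerZ !hornerM !(horner_size2 _ sp) !(horner_size2 _ sq).
  rewrite !(hornerD, hornerN, hornerC, hornerZ, hornerX).
  move=> pq; have -> : q`_0 = p`_0 + p`_1 * m - q`_1 * m by rewrite pq addrK.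
  by field; rewrite gt_eqF.
- exact: sz2.
- exact: sz2.
- by move=> x xi; rewrite hatl// cl// !hornerZ !hornerM mulrA.
- by move=> x xi; rewrite hatr// cr// !hornerZ !hornerM mulrA.
Qed.

End element_integrals.

End hat.

(** * The nodal equations *)

Section mesh.
Context {R : realType}.
Variables (a b : R) (N : nat).
Hypotheses (hab : a < b) (hN : (0 < N)%N).
Notation h := (mesh_size a b N).
Notation x_ := (node a b N).

Lemma mesh_size_gt0 : 0 < h.
Proof. by rewrite /mesh_size divr_gt0 ?subr_gt0 ?ltr0n. Qed.

Lemma node0 : x_ 0 = a.
Proof. by rewrite /node mul0r addr0. Qed.

Lemma nodeN : x_ N = b.
Proof. by rewrite /node /mesh_size; field; rewrite pnatr_eq0 -lt0n. Qed.

Lemma nodeS i : x_ i.+1 = x_ i + h.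
Proof. by rewrite /node -natr1; ring. Qed.

Lemma le_node i j : (i <= j)%N -> x_ i <= x_ j.
Proof. by move=> ij; rewrite lerD2l ler_wpM2r ?ler_nat// ltW// mesh_size_gt0. Qed.

Lemma interior_node_itv i : (0 < i < N)%N -> a <= x_ i - h /\ x_ i + h <= b.
Proof.
move=> /andP[i0 iN]; have := le_node (leq0n i.-1); have := le_node iN.
rewrite node0 nodeN nodeS => ? ai; split=> //.
by rewrite -(prednK i0) nodeS addrK.
Qed.

Lemma hat_P1 i : P1_space a b N (hat (x_ i) h).
Proof.
have h0 := mesh_size_gt0.
split; first by apply: continuous_subspaceT; exact: continuous_hat.
move=> j jN; have [ji|ij|->] := ltngtP j i.
- have [ji1|] := ltnP j.+1 i.
    exists 0; first by rewrite size_poly0.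
    move=> x; rewrite in_itv/= horner0 => /andP[_ xj]; rewrite hat_out//.
    by have := le_node ji1; rewrite [x_ j.+2]nodeS => ?; apply/orP; left; lra.
  move=> ij1; have -> : i = j.+1 by apply/eqP; rewrite eqn_leq ij1 ji.
  exists ((1 - x_ j.+1 / h)%:P + h^-1 *: 'X); first exact: size_affine_le2.
  move=> x; rewrite in_itv/= => xj; apply: hat_left => //.
  by rewrite nodeS addrK -nodeS.
- exists 0; first by rewrite size_poly0.
  move=> x; rewrite in_itv/= horner0 => /andP[xj _]; rewrite hat_out//.
  by have := le_node ij; rewrite nodeS => ?; apply/orP; right; lra.
- exists ((1 + x_ i / h)%:P - h^-1 *: 'X); first by rewrite -scaleNr size_affine_le2.
  by move=> x; rewrite in_itv/= nodeS => xj; exact: hat_right.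
Qed.

Lemma galerkin_nodal_equation (D alpha : R) (f c : R -> R) (ca cb : R) (i : nat) :
  galerkin_solution a b D alpha f ca cb N c -> (0 < i < N)%N ->
  D / h * (2 * c (x_ i) - c (x_ i.-1) - c (x_ i.+1)) +
  alpha * h / 6 * (c (x_ i.-1) + 4 * c (x_ i) + c (x_ i.+1)) =
  \int[@lebesgue_measure R]_(x in `[a, b]) (hat (x_ i) h x * f x).
Proof.
have h0 := mesh_size_gt0.
move=> [[_ cP1] _ _ galerkin] i0N; have [ax xb] := interior_node_itv i0N.
have /andP[i0 iN] := i0N.
rewrite -galerkin; last 3 first.
- exact: hat_P1.
- by rewrite hat_out// ax.
- by rewrite hat_out// xb orbT.
have [p sp cp] := cP1 _ (leq_ltn_trans (leq_pred i) iN).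
have [q sq cq] := cP1 _ iN.
rewrite prednK// in cp.
have subab : `[x_ i - h, x_ i + h]%classic `<=` `[a, b]%classic.
  by move=> x /=; rewrite !in_itv/= => /andP[? ?]; apply/andP; split; lra.
have out x : ~ `[x_ i - h, x_ i + h]%classic x ->
    (x < x_ i - h) || (x_ i + h < x).
  by move/negP; rewrite /= in_itv/= negb_and -!ltNge.
rewrite !(Rintegral_restrict subab); last 2 first.
- move=> x _ /out xo; rewrite hat_out ?mulr0 ?mul0r//.
  by case/orP: xo => /ltW ->; rewrite ?orbT.
- by move=> x _ /out xo; rewrite derive1_hat_out// mulr0 mul0r.
have xp : x_ i.-1 = x_ i - h by rewrite -{2}(prednK i0) nodeS addrK.
rewrite xp in cp *; rewrite nodeS in cq *.
by rewrite (stiffness_hat h0 sp sq cp cq) (mass_hat h0 sp sq cp cq).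
Qed.

Lemma load_ge0 (f : R -> R) (i : nat) : L2_on a b f ->
  {ae @lebesgue_measure R, forall x, x \in `]a, b[ -> 0 <= f x} ->
  (0 < i < N)%N ->
  0 <= \int[@lebesgue_measure R]_(x in `[a, b]) (hat (x_ i) h x * f x).
Proof.
move=> /sub_Lfun_mfun; rewrite inE /= => mf f0 i0N.
have h0 := mesh_size_gt0; have [ax xb] := interior_node_itv i0N.
(* f is measurable only after extension by zero outside ]a, b[; the change at
   the endpoints is harmless because the hat function vanishes there. *)
suff -> : \int[@lebesgue_measure R]_(x in `[a, b]) (hat (x_ i) h x * f x) =
    \int[@lebesgue_measure R]_(x in `[a, b])
      (hat (x_ i) h x * patch (fun=> 0) `]a, b[ f x).
  apply: Rintegral_ge0_ae => //.
  - apply: measurable_funM.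
    + apply/measurable_funTS; apply: continuous_measurable_fun.
      exact: continuous_hat.
    + exact/measurable_funTS.
  - case: f0 => A [mA A0 subA]; exists A; split => //.
    apply: subset_trans subA; apply: subsetC => x fx _.
    rewrite mulr_ge0 ?hat_ge0// patchE; case: ifPn => //.
    by rewrite inE; exact: fx.
apply: eq_Rintegral => x; rewrite inE /= in_itv/= => /andP[xa xb'].
rewrite patchE; case: ifPn => // /negP; rewrite inE /= in_itv/= => /negP.
rewrite negb_and -!leNgt => xout; rewrite hat_out ?mul0r//.
by case/orP: xout => ?; apply/orP; [left|right]; lra.
Qed.

End mesh.

(** * Non-negativity of the nodal values *)

Unset Implicit Arguments.

Theorem mainTheorem1 (R : realType) (a b D alpha : R) (f : R -> R) (ca cb : R)
    (N : nat) (ch : R -> R)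
    (hab : a < b) (hD : 0 < D) (halpha : 0 <= alpha)
    (hf : L2_on a b f)
    (hf0 : {ae @lebesgue_measure R, forall x, x \in `]a, b[ -> 0 <= f x})
    (hca : 0 <= ca) (hcb : 0 <= cb) (hN : (2 <= N)%N)
    (hch : galerkin_solution a b D alpha f ca cb N ch)
    (hh : alpha = 0 \/ mesh_size a b N <= Num.sqrt (6 * D / alpha)) :
  forall i : nat, (i <= N)%N -> 0 <= ch (node a b N i).
Proof.
have N0 : (0 < N)%N by exact: ltnW.
have h0 := mesh_size_gt0 hab N0.
set h := mesh_size a b N in h0 hh *.
have [_ ch_a ch_b _] := hch.
(* The mesh condition without the square root, uniformly in alpha. *)
have hk : alpha * h ^+ 2 <= 6 * D.
  case: hh => [->|hh]; first by rewrite mul0r mulr_ge0 ?ltW.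
  have [->|alpha0] := eqVneq alpha 0; first by rewrite mul0r mulr_ge0 ?ltW.
  have alpha_gt0 : 0 < alpha by rewrite lt_neqAle eq_sym alpha0.
  rewrite mulrC -ler_pdivlMr//.
  have r0 : 0 <= 6 * D / alpha by rewrite divr_ge0 ?mulr_ge0 ?(ltW hD).
  by rewrite -(sqr_sqrtr r0) ler_sqr// nnegrE ?sqrtr_ge0// ltW.
have Dh : 0 < D / h by rewrite divr_gt0.
have ah : 0 <= alpha * h by rewrite mulr_ge0// ltW.
apply: (@discrete_maximum_principle R (D / h - alpha * h / 6) (alpha * h)).
- rewrite subr_ge0 ler_pdivlMr// mulrAC ler_pdivrMr//.
  by rewrite -mulrA -expr2 [D * _]mulrC.
- by [].
- by lra.
- by rewrite node0 ch_a.
- by rewrite nodeN// ch_b.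
- move=> i iN; have := load_ge0 hab N0 hf hf0 iN.
  by rewrite -(galerkin_nodal_equation hab N0 hch iN) -/h; lra.
Qed.
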